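(* Let $P$ be a forest poset and let $t\geq 2$ be an integer. Then the simplicial complex $\Delta_t(P)$ is a simplicial forest.
   Context: Posets are finite. The Hasse diagram of a poset $P$ has the elements of $P$ as vertices and an edge from $x$ to $y$ whenever $y$ covers $x$. A pencil is a poset whose elements can be written as a disjoint union $\{x_1,\ldots,x_r\}\cup\{z\}\cup\{y_1,\ldots,y_m\}$ with $r,m\geq 2$ such that $x_i<z<y_j$ for all $i,j$, and the sets $\{x_1,\ldots,x_r\}$ and $\{y_1,\ldots,y_m\}$ are both antichains. A poset is a tree (poset) if its Hasse diagram is a tree as an undirected graph and it does not contain any pencil as a subposet. A forest (poset) is a disjoint union of tree posets. A path of length $t$ in $P$ is a saturated chain of $t$ elements (each element covers the previous one). $\Delta_t(P)$ is the simplicial complex whose facets are exactly the vertex sets of the paths of length $t$ in $P$. Let $\mathcal{F}(\Delta)$ be the set of facets of a simplicial complex $\Delta$. A facet $F$ of $\Delta$ is a leaf if either $F$ is the only facet of $\Delta$ or there exists a facet $G\neq F$ of $\Delta$ such that $F\cap H\subseteq F\cap G$ for every $H\in\mathcal{F}(\Delta)$ with $H\neq F$. $\Delta$ is a simplicial tree if it is connected and every non-empty subcomplex generated by a subset of $\mathcal{F}(\Delta)$ contains a leaf; by convention the empty complex is a simplicial tree. A simplicial forest is a simplicial complex all of whose connected components are simplicial trees. *)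

(* Defs.v *)
From mathcomp Require Import all_boot all_order.
Set Implicit Arguments.
Unset Strict Implicit.
Unset Printing Implicit Defensive.
Import Order.TTheory.
Local Open Scope order_scope.

(* Throughout, a set A of elements of a finite poset T stands for the subposet
   of T that it induces. *)

Definition covered_in d (T : finPOrderType d) (A : {set T}) : rel T :=
  fun x y => [&& x \in A, y \in A, x < y & [forall z in A, ~~ (x < z < y)]].

Definition hasse_edge d (T : finPOrderType d) (A : {set T}) : rel T :=
  fun x y => covered_in A x y || covered_in A y x.

(* e is meant to be symmetric, irreflexive and supported on V.  Sequences of
   size 2 are excluded because they traverse a single edge back and forth. *)
Definition graph_tree (T : finType) (V : {set T}) (e : rel T) : Prop :=
  [/\ V != set0,
      {in V &, forall x y, connect e x y} &
      forall c : seq T, ucycle e c -> (size c <= 2)%N].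

Definition antichain d (T : finPOrderType d) (X : {set T}) : Prop :=
  {in X &, forall x y, x != y -> x >< y}.

Definition pencil d (T : finPOrderType d) (A : {set T}) : Prop :=
  exists (X : {set T}) (z : T) (Y : {set T}),
    [/\ A = X :|: [set z] :|: Y,
        [/\ [disjoint X & Y], z \notin X & z \notin Y],
        (2 <= #|X|)%N /\ (2 <= #|Y|)%N,
        forall x y, x \in X -> y \in Y -> x < z < y &
        antichain X /\ antichain Y].

Definition tree_poset d (T : finPOrderType d) (A : {set T}) : Prop :=
  graph_tree A (hasse_edge A) /\
  forall B : {set T}, B \subset A -> ~ pencil B.

Definition forest_poset d (T : finPOrderType d) : Prop :=
  exists Q : {set {set T}},
    [/\ partition Q [set: T],
        forall A B, A \in Q -> B \in Q -> A != B ->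
          forall a b, a \in A -> b \in B -> a >< b &
        forall A, A \in Q -> tree_poset A].

(* A simplicial complex is given by its set of faces; its vertices are the v
   such that [set v] is a face.  The complex without any face is allowed. *)
Definition simplicial_complex (V : finType) (D : {set {set V}}) : Prop :=
  forall F G : {set V}, F \in D -> G \subset F -> G \in D.

Definition facets (V : finType) (D : {set {set V}}) : {set {set V}} :=
  [set F | maxset (mem D) F].

Definition generated (V : finType) (S : {set {set V}}) : {set {set V}} :=
  [set F : {set V} | [exists G in S, F \subset G]].

Definition leaf (V : finType) (D : {set {set V}}) (F : {set V}) : Prop :=
  F \in facets D /\
  (facets D = [set F] \/
   exists G : {set V},
     [/\ G \in facets D, G != F &
         forall H, H \in facets D -> H != F -> F :&: H \subset F :&: G]).

(* Connectedness of the 1-skeleton; the complexes set0 and [set set0], which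
   have no vertex, are connected. *)
Definition connected_complex (V : finType) (D : {set {set V}}) : Prop :=
  forall u v : V, [set u] \in D -> [set v] \in D ->
    connect [rel x y : V | [set x; y] \in D] u v.

Definition simplicial_tree (V : finType) (D : {set {set V}}) : Prop :=
  [/\ simplicial_complex D,
      connected_complex D &
      forall S : {set {set V}}, S \subset facets D -> generated S != set0 ->
        exists F, leaf (generated S) F].

Definition connected_subcomplex (V : finType) (D C : {set {set V}}) : Prop :=
  [/\ C \subset D, simplicial_complex C & connected_complex C].

Definition connected_component (V : finType) (D C : {set {set V}}) : Prop :=
  connected_subcomplex D C /\
  forall C', connected_subcomplex D C' -> C \subset C' -> C' = C.

Definition simplicial_forest (V : finType) (D : {set {set V}}) : Prop :=
  simplicial_complex D /\
  forall C, connected_component D C -> simplicial_tree C.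

(* The length of a path is its number of elements. *)
Definition poset_path d (T : finPOrderType d) (t : nat) (s : t.-tuple T) :=
  sorted (covered_in [set: T]) s.

Definition path_complex d (T : finPOrderType d) (t : nat) : {set {set T}} :=
  generated [set [set x in s] | s : t.-tuple T & poset_path s].

(* Main.v *)
Require Import Defs.
From mathcomp Require Import all_boot all_order.

(* Every edge of the Hasse diagram of a forest poset is a bridge; hence
   intervals are chains and saturated paths are convex chains.  Call an element
   v of a convex set A simple if it is minimal in A and the elements of A above
   it form a chain, or dually.  Two convex chains through a simple v have nested
   traces on A, and then the one with the smaller trace is a leaf; if at most
   one member of the family contains v, a leaf of the family of traces on
   A :\ v is a leaf of the family of traces on A.

   Simple elements exist in any nonempty convex A.  Let D be the set of elements
   of A whose down-set in A is a chain.  If A has no simple element, then every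
   maximal element of A is outside D, while every minimal one is inside; so some
   cover relation x < y of A leaves D.  Removing the edge xy cuts off one side of
   the Hasse diagram, and without pencils and simple elements each of the two
   sides properly contains a side of another such edge, which is absurd. *)

Set Implicit Arguments.
Unset Strict Implicit.
Unset Printing Implicit Defensive.
Import Order.TTheory.
Local Open Scope order_scope.

(** * Bridges in finite graphs *)

Definition del_edge (T : finType) (e : rel T) (x y : T) : rel T :=
  [rel u v | e u v && ([set u; v] != [set x; y])].

Lemma del_edge_sym (T : finType) (e : rel T) x y :
  symmetric e -> symmetric (del_edge e x y).
Proof. by move=> es u v; rewrite /del_edge /= es setUC. Qed.

(** Shortened to a path without repetition, a walk avoiding the edge closes with it to a cycle. This
    cycle has at least three vertices, since a path of a single step would be the deleted edge. *)
Lemma acyclic_bridge (T : finType) (e : rel T) x y :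
  symmetric e -> (forall c : seq T, ucycle e c -> (size c <= 2)%N) ->
  e x y -> x != y -> ~~ connect (del_edge e x y) x y.
Proof.
move=> es ac exy nxy; apply/connectP => -[p ep yE].
case/shortenP: ep yE => p' ep' up' _ yE.
have /ac /= : ucycle e (x :: p').
  apply/andP; split=> //; rewrite /cycle rcons_path -yE es exy andbT.
  by apply: sub_path ep' => u v /andP[].
case: p' ep' up' yE => [|z [|z' p']] //= ep' _ yE; first by rewrite yE eqxx in nxy.
by move: ep'; rewrite /del_edge /= -yE eqxx andbF.
Qed.

(* A walk from s that avoids the edge xy reaches neither a nor b, so it also
   avoids the edge ab. *)
Lemma component_sub (T : finType) (e : rel T) a b x y s :
  ~~ connect (del_edge e x y) s a -> ~~ connect (del_edge e x y) s b ->
  forall u, connect (del_edge e x y) s u -> connect (del_edge e a b) s u.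
Proof.
move=> sa sb u /connectP[p ep ->].
elim/last_ind: p ep => [|p z IH] //=; rewrite rcons_path last_rcons => /andP[ep ez].
apply: connect_trans (IH ep) (connect1 _).
have sl : connect (del_edge e x y) s (last s p) by apply/connectP; exists p.
case/andP: (ez) => el _; rewrite /del_edge /= el /=; apply: contraNneq sa => E.
have : a \in [set last s p; z] by rewrite E !inE eqxx.
rewrite !inE => /orP[]/eqP-> //.
exact: connect_trans sl (connect1 ez).
Qed.

(** * Cover relations and walks in the Hasse diagram *)

Definition covers d (T : finPOrderType d) : rel T := covered_in [set: T].
Definition hedge d (T : finPOrderType d) : rel T := hasse_edge [set: T].

Lemma coversP d (T : finPOrderType d) (x y : T) :
  reflect (x < y /\ forall z, x < z -> z < y -> False) (covers x y).
Proof.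
rewrite /covers /covered_in !inE /=; apply: (iffP andP) => -[xy H]; split=> //.
  by move=> z xz zy; move/forall_inP: H => /(_ z (in_setT z)); rewrite xz zy.
by apply/forall_inP => z _; apply/negP => /andP[] /H.
Qed.

Lemma covers_lt d (T : finPOrderType d) (x y : T) : covers x y -> x < y.
Proof. by case/coversP. Qed.

Lemma hedge_sym d (T : finPOrderType d) : symmetric (@hedge d T).
Proof. by move=> x y; rewrite /hedge /hasse_edge orbC. Qed.

Lemma hedgeE d (T : finPOrderType d) (x y : T) :
  hedge x y = covers x y || covers y x.
Proof. by []. Qed.

Lemma set2_lt_inj d (T : finPOrderType d) (x y u v : T) :
  x < y -> u < v -> [set u; v] = [set x; y] -> (u = x) * (v = y).
Proof.
move=> xy uv E.
have : u \in [set x; y] by rewrite -E !inE eqxx.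
have : v \in [set x; y] by rewrite -E !inE eqxx orbT.
rewrite !inE => /orP[]/eqP vE /orP[]/eqP uE; subst u v; rewrite ?ltxx // in uv *.
by move: (lt_trans xy uv); rewrite ltxx.
Qed.

Lemma ex_maximal d (T : finPOrderType d) (R : pred T) x :
  R x -> exists2 y, x <= y & R y /\ forall z, R z -> y <= z -> z = y.
Proof.
move=> Rx.
(* Down-sets grow strictly along [<], so a largest one belongs to a maximal element. *)
have [y /andP[Ry xy] ymax] := @arg_maxnP _ x [pred y | R y && (x <= y)]
   (fun y => #|[set z | z <= y]|) (introT andP (conj Rx (lexx x))).
exists y => //; split=> // z Rz yz; apply/eqP; apply: contraT => nzy.
have zR : R z && (x <= z) by rewrite Rz (le_trans xy yz).
move: (ymax z zR); rewrite /= leqNgt => /negP[]; apply: proper_card.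
apply/properP; split; first by apply/subsetP => w; rewrite !inE => /le_trans; apply.
by exists z; rewrite !inE // lt_geF // lt_def nzy.
Qed.

Lemma ex_minimal d (T : finPOrderType d) (R : pred T) x :
  R x -> exists2 y, y <= x & R y /\ forall z, R z -> z <= y -> z = y.
Proof. exact: (@ex_maximal _ (T^d)). Qed.

Lemma ex_cover d (T : finPOrderType d) (x y : T) :
  x < y -> exists2 z, covers x z & z <= y.
Proof.
move=> xy; have [z zy [xz zmin]] := @ex_minimal _ _ [pred w | x < w] _ xy.
exists z => //; apply/coversP; split=> // w xw wz.
by have E := zmin w xw (ltW wz); rewrite E ltxx in wz.
Qed.

(* A saturated chain from u to v uses the edge xy only if u <= x and y <= v. *)
Lemma le_connect d (T : finPOrderType d) (x y u v : T) :
  x < y -> u <= v -> ~~ ((u <= x) && (y <= v)) ->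
  connect (del_edge (@hedge d T) x y) u v.
Proof.
move=> xy; have [n] := ubnP #|[set w | u <= w]|.
elim: n u => // n IH u; rewrite ltnS => cu uv nuv.
move: uv; rewrite le_eqVlt => /orP[/eqP->|ltuv]; first exact: connect0.
have [w uw wv] := ex_cover ltuv; have ltuw := covers_lt uw.
apply: (@connect_trans _ _ w).
  apply: connect1; rewrite /del_edge /= hedgeE uw /=.
  apply: contra nuv => /eqP /(set2_lt_inj xy ltuw) [-> <-].
  by rewrite lexx.
apply: IH wv _.
  apply: leq_trans cu; apply: proper_card; apply/properP; split.
    by apply/subsetP => z; rewrite !inE; apply: le_trans; apply: ltW.
  by exists u; rewrite !inE ?lexx // lt_geF.
by apply: contra nuv => /andP[wx ->]; rewrite (le_trans (ltW ltuw) wx).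
Qed.

(** * Order-theoretic consequences of all Hasse edges being bridges *)

Definition hasse_bridges d (T : finPOrderType d) : Prop :=
  forall x y : T, covers x y -> ~~ connect (del_edge (@hedge d T) x y) x y.

Section Bridges.
Context d (T : finPOrderType d) (br : hasse_bridges T).
Implicit Types x y z u v a b p q : T.

Let e' x y := del_edge (@hedge d T) x y.
Let csym x y : connect_sym (e' x y).
Proof. by apply: sym_connect_sym; apply: del_edge_sym; apply: hedge_sym. Qed.

(* Otherwise x < z <= b >= y joins x to y without the edge xy. *)
Lemma cover_le x y z b : covers x y -> x < z -> z <= b -> y <= b -> y <= z.
Proof.
move=> xy xz zb yb; apply: contraT => nyz; have ltxy := covers_lt xy.
case/negP: (br xy); apply: (@connect_trans _ _ z).
  by apply: le_connect => //; [apply: ltW | rewrite (negPf nyz) andbF].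
apply: (@connect_trans _ _ b).
  by apply: le_connect => //; rewrite (lt_geF xz).
by rewrite csym; apply: le_connect => //; rewrite (lt_geF ltxy).
Qed.

(** Dually to [cover_le], the walk [x >= a <= z < y] would otherwise bypass the edge [xy]. *)
Lemma cocover_le x y z a : covers x y -> z < y -> a <= z -> a <= x -> z <= x.
Proof.
move=> xy zy az ax; apply: contraT => nzx; have ltxy := covers_lt xy.
case/negP: (br xy); apply: (@connect_trans _ _ a).
  by rewrite csym; apply: le_connect => //; rewrite (lt_geF ltxy) andbF.
apply: (@connect_trans _ _ z).
  by apply: le_connect => //; rewrite (lt_geF zy) andbF.
by apply: le_connect => //; [apply: ltW | rewrite (negPf nzx)].
Qed.

(** A cover of [a] below [p] is also below [q] by [cover_le], so [a] can move up until it meets [p]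
    or [q]. *)
Lemma interval_comparable a b p q :
  a <= p -> a <= q -> p <= b -> q <= b -> p >=< q.
Proof.
have [n] := ubnP #|[set w | a <= w]|.
elim: n a => // n IH a; rewrite ltnS => ca ap aq pb qb.
move: (ap) (aq); rewrite le_eqVlt => /orP[/eqP<- _|ltap]; first by rewrite /Order.comparable aq.
rewrite le_eqVlt => /orP[/eqP<-|ltaq]; first by rewrite /Order.comparable ap orbT.
have [w aw wp] := ex_cover ltap; have ltaw := covers_lt aw.
apply: (IH w) => //.
  apply: leq_trans ca; apply: proper_card; apply/properP; split.
    by apply/subsetP => z; rewrite !inE; apply: le_trans; apply: ltW.
  by exists a; rewrite !inE ?lexx // lt_geF.
by apply: cover_le aw ltaq qb _; apply: le_trans wp pb.
Qed.
Lemma del_edge_covers x y u v :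
  covers x y -> covers u v -> (u != x) || (v != y) -> e' x y u v.
Proof.
move=> xy uv ne; rewrite /e' /del_edge /= hedgeE uv /=.
apply: contraTneq ne => /(set2_lt_inj (covers_lt xy) (covers_lt uv)) [-> ->].
by rewrite !eqxx.
Qed.

(** * Convex sets and their simple elements *)

(** Only five-element pencils are excluded here; every pencil contains one of them. *)
Definition pencil_free := forall p q z a b,
  p < z -> q < z -> z < a -> z < b -> p >< q -> a >< b -> False.

Definition convex (A : {set T}) :=
  forall x y z, x \in A -> z \in A -> x <= y -> y <= z -> y \in A.

Definition chain_below (A : {set T}) z :=
  [forall p in A, forall q in A, (p <= z) && (q <= z) ==> (p >=< q)].

Definition chain_above (A : {set T}) z :=
  [forall p in A, forall q in A, (z <= p) && (z <= q) ==> (p >=< q)].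

Lemma chain_belowP (A : {set T}) z :
  reflect (forall p q, p \in A -> q \in A -> p <= z -> q <= z -> p >=< q)
          (chain_below A z).
Proof.
apply: (iffP forall_inP) => H.
  move=> p q pA qA pz qz; move/forall_inP: (H p pA) => /(_ q qA).
  by rewrite pz qz.
move=> p pA; apply/forall_inP => q qA; apply/implyP => /andP[pz qz].
exact: H.
Qed.

Lemma chain_aboveP (A : {set T}) z :
  reflect (forall p q, p \in A -> q \in A -> z <= p -> z <= q -> p >=< q)
          (chain_above A z).
Proof.
apply: (iffP forall_inP) => H.
  move=> p q pA qA pz qz; move/forall_inP: (H p pA) => /(_ q qA).
  by rewrite pz qz.
move=> p pA; apply/forall_inP => q qA; apply/implyP => /andP[pz qz].
exact: H.
Qed.

Lemma chain_belowPn (A : {set T}) z :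
  ~~ chain_below A z ->
  exists p q, [/\ p \in A, q \in A, p < z, q < z & p >< q].
Proof.
rewrite negb_forall_in => /exists_inP[p pA].
rewrite negb_forall_in => /exists_inP[q qA].
rewrite negb_imply => /andP[/andP[pz qz] pq]; exists p, q; split=> //.
  rewrite lt_neqAle pz andbT; apply: contraNneq pq => ->.
  by rewrite /Order.comparable qz orbT.
rewrite lt_neqAle qz andbT; apply: contraNneq pq => ->.
by rewrite /Order.comparable pz.
Qed.

Lemma chain_abovePn (A : {set T}) z :
  ~~ chain_above A z ->
  exists p q, [/\ p \in A, q \in A, z < p, z < q & p >< q].
Proof.
rewrite negb_forall_in => /exists_inP[p pA].
rewrite negb_forall_in => /exists_inP[q qA].
rewrite negb_imply => /andP[/andP[pz qz] pq]; exists p, q; split=> //.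
  rewrite lt_neqAle pz andbT; apply: contraNneq pq => <-.
  by rewrite /Order.comparable qz.
rewrite lt_neqAle qz andbT; apply: contraNneq pq => <-.
by rewrite /Order.comparable pz orbT.
Qed.

Lemma chain_below_le (A : {set T}) x y :
  x <= y -> chain_below A y -> chain_below A x.
Proof.
move=> xy /chain_belowP H; apply/chain_belowP => p q pA qA px qx.
by apply: H => //; apply: le_trans xy.
Qed.

Definition min_in (A : {set T}) v := [forall u in A, (u <= v) ==> (u == v)].
Definition max_in (A : {set T}) v := [forall u in A, (v <= u) ==> (u == v)].

Lemma min_inP (A : {set T}) v :
  reflect (forall u, u \in A -> u <= v -> u = v) (min_in A v).
Proof.
apply: (iffP forall_inP) => H u uA; last by apply/implyP => uv; apply/eqP/H.
by move/implyP: (H u uA) => uv /uv /eqP.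
Qed.

Lemma max_inP (A : {set T}) v :
  reflect (forall u, u \in A -> v <= u -> u = v) (max_in A v).
Proof.
apply: (iffP forall_inP) => H u uA; last by apply/implyP => uv; apply/eqP/H.
by move/implyP: (H u uA) => uv /uv /eqP.
Qed.

Lemma ex_min_in (A : {set T}) a :
  a \in A -> exists v, [/\ v <= a, v \in A & min_in A v].
Proof.
case/(@ex_minimal _ _ (mem A)) => v va [vA vmin].
by exists v; split=> //; apply/min_inP.
Qed.

Lemma ex_max_in (A : {set T}) a :
  a \in A -> exists v, [/\ a <= v, v \in A & max_in A v].
Proof.
case/(@ex_maximal _ _ (mem A)) => v va [vA vmin].
by exists v; split=> //; apply/max_inP.
Qed.

Lemma min_in_chain_below (A : {set T}) v : min_in A v -> chain_below A v.
Proof.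
by move=> /min_inP vmin; apply/chain_belowP => p q /vmin H /vmin H' /H-> /H'->; exact: comparablexx.
Qed.

Definition simple_in (A : {set T}) v :=
  (v \in A) && (min_in A v && chain_above A v || max_in A v && chain_below A v).

Definition crossing (A : {set T}) x y :=
  [&& covers x y, x \in A, y \in A, chain_below A x & ~~ chain_below A y].

(** Among the elements between [v] and [m] whose down-set in [A] is a chain, [x] is maximal; its
    cover [y] below [m] therefore fails this condition. *)
Lemma ex_crossing (A : {set T}) v m :
  convex A -> v \in A -> m \in A -> v <= m ->
  chain_below A v -> ~~ chain_below A m ->
  exists x y, [/\ crossing A x y, v <= x & y <= m].
Proof.
move=> cA vA mA vm Dv Dm.
have [|x vx [/andP[xm Dx] xmax]] :=
  @ex_maximal _ _ [pred w | (w <= m) && chain_below A w] v.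
  by rewrite /= vm Dv.
have ltxm : x < m.
  by rewrite lt_neqAle xm andbT; apply: contraNneq Dm => <-.
have [y xy ym] := ex_cover ltxm; have ltxy := covers_lt xy.
exists x, y; split=> //; rewrite /crossing xy Dx /=.
rewrite (cA v x m) // (cA v y m) ?(le_trans vx (ltW ltxy)) //=.
apply/negP => Dy; have E : y = x by apply: xmax (ltW ltxy); rewrite /= ym Dy.
by rewrite E ltxx in ltxy.
Qed.

(* The two sides into which the removal of the edge xy splits the component of
   this edge in the Hasse diagram. *)
Definition side_dn x y := [set u | connect (e' x y) x u].
Definition side_up x y := [set u | connect (e' x y) y u].

(* y is above some p not below x; a minimal element of A below p leads to the
   new crossing edge. *)
Lemma side_up_proper (A : {set T}) x y :
  convex A -> crossing A x y ->
  exists x' y', crossing A x' y' /\ side_dn x' y' \proper side_up x y.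
Proof.
move=> cA /and5P[xy xA yA Dx Dy]; have ltxy := covers_lt xy.
(* Two incomparable elements below [y] cannot both lie below [x], whose down-set in [A] is a
   chain. *)
have [p [pA ltpy npx]] : exists p, [/\ p \in A, p < y & ~~ (p <= x)].
  have [p [q [pA qA py qy pq]]] := chain_belowPn Dy.
  case: (boolP (p <= x)) => [px|]; last by exists p.
  exists q; split=> //; apply: contra pq => qx.
  exact: (chain_belowP _ _ Dx).
have [v [vp vA vmin]] := ex_min_in pA.
have nvx : ~~ (v <= x) by apply: contra npx => vx; apply: cocover_le xy ltpy vp vx.
have [x' [y' [cr' vx' y'y]]] :=
  ex_crossing cA vA yA (le_trans vp (ltW ltpy)) (min_in_chain_below vmin) Dy.
exists x', y'; split=> //; case/and5P: cr' => x'y' x'A y'A Dx' Dy'.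
have ltx'y' := covers_lt x'y'.
have nx'x : ~~ (x' <= x) by apply: contra nvx; apply: le_trans vx'.
have ne : (x' != x) || (y' != y).
  by apply/orP; left; apply: contraNneq nx'x => ->.
have ne' : (x != x') || (y != y') by rewrite ![x == _]eq_sym ![y == _]eq_sym.
have y'y_conn : connect (e' x' y') y' y.
  by apply: le_connect => //; rewrite (lt_geF ltx'y').
have nx'y : ~~ connect (e' x' y') x' y.
  apply: contra (br x'y') => h; apply: connect_trans h _.
  by rewrite csym.
have nx'x_conn : ~~ connect (e' x' y') x' x.
  apply: contra nx'y => h; apply: connect_trans h (connect1 _).
  exact: del_edge_covers.
have yx' : connect (e' x y) y x'.
  rewrite csym; apply: connect_trans (connect1 (del_edge_covers xy x'y' ne)) _.
  apply: le_connect => //; apply: contra nx'x => /andP[y'x _].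
  exact: le_trans (ltW ltx'y') y'x.
(* The inclusion is strict because of [y]. Walks from [x'] that avoid [x'y'] reach neither [x] nor
   [y], so they avoid [xy] as well. *)
apply/properP; split; last by exists y; rewrite !inE.
apply/subsetP => u; rewrite !inE => x'u; apply: connect_trans yx' _.
exact: component_sub x'u.
Qed.

(* In the absence of pencils the elements above y form a chain, while a minimal
   r below x is not simple; so r is below some p with neither y <= p nor p <= x,
   and a maximal element of A above p leads to the new crossing edge. *)
Lemma side_dn_proper (A : {set T}) x y :
  pencil_free -> convex A -> (forall v, ~~ simple_in A v) -> crossing A x y ->
  exists x' y', crossing A x' y' /\ side_up x' y' \proper side_dn x y.
Proof.
move=> pf cA ns /and5P[xy xA yA Dx Dy]; have ltxy := covers_lt xy.
have [r [rx rA rmin]] := ex_min_in xA.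
have [p [pA rp nyp npx]] :
    exists p, [/\ p \in A, r < p, ~~ (y <= p) & ~~ (p <= x)].
  have [|p [q [pA qA rp rq pq]]] := @chain_abovePn A r.
    by have := ns r; rewrite /simple_in rA rmin /= negb_or => /andP[].
  have npq : ~~ (p <= q) by apply: contra pq => pq; rewrite /Order.comparable pq.
  have nqp : ~~ (q <= p) by apply: contra pq => pq; rewrite /Order.comparable pq orbT.
  case: (boolP (y <= p)) => [yp|nyp]; last case: (boolP (p <= x)) => [px|npx].
  - exists q; split=> //.
      (* Otherwise [y], two incomparable elements below it, and [p], [q] above it form a pencil. *)
      apply/negP => yq; have [a [b [_ _ ay b_y ab]]] := chain_belowPn Dy.
      apply: (pf a b y p q) => //; rewrite lt_neqAle ?yp ?yq andbT.
        by apply: contraNneq npq => <-.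
      by apply: contraNneq nqp => <-.
    apply: contra nqp => qx; apply: le_trans qx (le_trans (ltW ltxy) yp).
  - exists q; split=> //.
      apply: contra npq => yq; apply: le_trans px (le_trans (ltW ltxy) yq).
    by apply: contra pq => qx; apply: (chain_belowP _ _ Dx).
  by exists p.
have [m [pm mA mmax]] := ex_max_in pA.
(* If [y <= m], then [x] and [p] both lie between [r] and [m], hence are comparable; so [x < p], and
   [cover_le] gives [y <= p]. *)
have nym : ~~ (y <= m).
  apply/negP => ym.
  have xm : x <= m := le_trans (ltW ltxy) ym.
  have /orP[xp|px] := interval_comparable rx (ltW rp) xm pm; last by rewrite px in npx.
  have ltxp : x < p by rewrite lt_neqAle xp andbT; apply: contraNneq npx => ->.
  by rewrite (cover_le xy ltxp pm ym) in nyp.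
have Dm : ~~ chain_below A m.
  by have := ns m; rewrite /simple_in mA mmax /= negb_or => /andP[].
have rm : r <= m := le_trans (ltW rp) pm.
have [x' [y' [cr' rx' y'm]]] :=
  ex_crossing cA rA mA rm (min_in_chain_below rmin) Dm.
exists x', y'; split=> //; case/and5P: cr' => x'y' x'A y'A Dx' Dy'.
have ltx'y' := covers_lt x'y'.
have nyy' : ~~ (y <= y') by apply: contra nym => /le_trans; apply.
have ny'x : ~~ (y' <= x) by apply: contra Dy' => /chain_below_le; apply.
have ne : (x' != x) || (y' != y).
  by apply/orP; right; apply: contraNneq nyy' => ->.
have ne' : (x != x') || (y != y') by rewrite ![x == _]eq_sym ![y == _]eq_sym.
(* Going down from [x] to [r] and up to [x'] avoids [x'y'], since [y'] is below neither [x] nor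
   [x']. *)
have xx'_conn : connect (e' x' y') x x'.
  apply: (@connect_trans _ _ r); last first.
    by apply: le_connect => //; rewrite (lt_geF ltx'y') andbF.
  by rewrite csym; apply: le_connect => //; rewrite (negPf ny'x) andbF.
have ny'x_conn : ~~ connect (e' x' y') y' x.
  apply: contra (br x'y') => h; rewrite csym; apply: connect_trans h _.
  exact: xx'_conn.
have ny'y_conn : ~~ connect (e' x' y') y' y.
  apply: contra ny'x_conn => h; apply: connect_trans h _.
  rewrite csym; apply: connect1; exact: del_edge_covers.
have xy'_conn : connect (e' x y) x y'.
  apply: (@connect_trans _ _ r).
    by rewrite csym; apply: le_connect => //; rewrite (lt_geF ltxy) andbF.
  apply: le_connect => //; first exact: le_trans rx' (ltW ltx'y').
  by rewrite (negPf nyy') andbF.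
apply/properP; split; last by exists x; rewrite !inE.
apply/subsetP => u; rewrite !inE => y'u; apply: connect_trans xy'_conn _.
exact: component_sub y'u.
Qed.

Lemma ex_simple (A : {set T}) :
  pencil_free -> convex A -> A != set0 -> exists v, simple_in A v.
Proof.
move=> pf cA /set0Pn[a aA].
apply/existsP; apply: contraT; rewrite negb_exists => /forallP ns.
have [v [va vA vmin]] := ex_min_in aA.
have [m [am mA mmax]] := ex_max_in aA.
have Dm : ~~ chain_below A m.
  by have := ns m; rewrite /simple_in mA mmax /= negb_or => /andP[].
have [x [y [cr _ _]]] :=
  ex_crossing cA vA mA (le_trans va am) (min_in_chain_below vmin) Dm.
(* Two steps lead to a crossing edge with a strictly smaller lower side: infinite descent. *)
suff: False by []; have [n] := ubnP #|side_dn x y|; elim: n x y cr => // n IH x y cr.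
have [x' [y' [cr' s']]] := side_dn_proper pf cA ns cr.
have [x'' [y'' [cr'' s'']]] := side_up_proper cA cr'.
rewrite ltnS => sn; apply: IH cr'' _.
apply: leq_trans sn; apply: proper_card; apply: proper_trans s'' s'.
Qed.

(** * Leaves in families of convex chains *)

Definition convex_chain (F : {set T}) :=
  convex F /\ forall p q, p \in F -> q \in F -> p >=< q.

(** For [v] minimal, elements [a] of [F] outside [G] and [b] of [G] outside [F] both lie above [v],
    hence are comparable. If [a <= b], convexity of [G] puts [a] in [G]; the other cases are
    similar. *)
Lemma simple_nested (A F G : {set T}) v :
  simple_in A v -> convex_chain F -> convex_chain G -> v \in F -> v \in G ->
  (F :&: A \subset G) || (G :&: A \subset F).
Proof.
move=> /andP[vA sv] [cF chF] [cG chG] vF vG.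
apply: contraT; rewrite negb_or => /andP[/subsetPn[a /setIP[aF aA] aG]].
case/subsetPn=> b /setIP[bG bA] bF.
case/orP: sv => /andP[].
  move/min_inP=> vmin /chain_aboveP up.
  have va : v <= a.
    by have /orP[//|av] := chF v a vF aF; rewrite (vmin a).
  have vb : v <= b.
    by have /orP[//|bv] := chG v b vG bG; rewrite (vmin b).
  case/orP: (up a b aA bA va vb) => [ab|ba].
    by rewrite (cG v a b) in aG.
  by rewrite (cF v b a) in bF.
move/max_inP=> vmax /chain_belowP dn.
have va : a <= v.
  by have /orP[av|//] := chF v a vF aF; rewrite (vmax a).
have vb : b <= v.
  by have /orP[bv|//] := chG v b vG bG; rewrite (vmax b).
case/orP: (dn a b aA bA va vb) => [ab|ba].
  by rewrite (cF a b v) in bF.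
by rewrite (cG b a v) in aG.
Qed.

(** A simple element is minimal or maximal, so it is never strictly between two elements of [A]. *)
Lemma convex_del_simple (A : {set T}) v :
  convex A -> simple_in A v -> convex (A :\ v).
Proof.
move=> cA /andP[vA sv] x y z /setD1P[xv xA] /setD1P[zv zA] xy yz.
rewrite !inE (cA x y z) // andbT.
apply: contraTneq sv => E; subst y; rewrite negb_or !negb_and.
have -> : ~~ min_in A v.
  by apply: contra xv => /min_inP H; rewrite (H x).
suff -> : ~~ max_in A v by [].
by apply: contra zv => /max_inP H; rewrite (H z).
Qed.

(** Restricting the leaf condition to [A] permits induction on the size of [A], deleting one simple
    element at a time. *)
Lemma ex_leaf (S : {set {set T}}) (A : {set T}) :
  pencil_free -> {in S, forall F, convex_chain F} -> S != set0 -> convex A ->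
  exists2 F, F \in S & S = [set F] \/ exists G, [/\ G \in S, G != F &
    forall H, H \in S -> H != F -> F :&: H :&: A \subset G].
Proof.
move=> pf cS /set0Pn[F0 F0S].
have [n] := ubnP #|A|; elim: n A => // n IH A; rewrite ltnS => An cA.
have [A0|nA0] := eqVneq A set0.
  exists F0 => //; case: (set_0Vmem (S :\ F0)) => [E|[G /setD1P[GF GS]]].
    by left; rewrite -(setD1K F0S) E setU0.
  by right; exists G; split=> // H _ _; rewrite A0 setI0 sub0set.
have [v sv] := ex_simple pf cA nA0; case/andP: (sv) => vA _.
case: (boolP [exists F in S, [exists G in S, [&& G != F, v \in F & v \in G]]]).
  case/exists_inP => F FS /exists_inP[G GS /and3P[GF vF vG]].
  case/orP: (simple_nested sv (cS F FS) (cS G GS) vF vG) => sub.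
    exists F => //; right; exists G; split=> // H _ _.
    by apply: subset_trans sub; apply: setSI; apply: subsetIl.
  exists G => //; right; exists F; split=> //; first by rewrite eq_sym.
  by move=> H _ _; apply: subset_trans sub; apply: setSI; apply: subsetIl.
rewrite negb_exists_in => /forall_inP nv.
have [||F FS LF] := IH (A :\ v).
- by apply: leq_trans An; rewrite (cardsD1 v A) vA.
- exact: convex_del_simple.
exists F => //; case: LF => [|[G [GS GF LG]]]; [by left | right].
exists G; split=> // H HS HF.
(* The restored element [v] cannot lie in [F :&: H], because no two members of [S] share it. *)
apply/subsetP => w /setIP[/setIP[wF wH] wA].
have [wv|nwv] := eqVneq w v.
  subst w; move: (nv F FS); rewrite negb_exists_in => /forall_inP /(_ H HS).
  by rewrite HF wF wH.
by apply: (subsetP (LG H HS HF)); rewrite !inE wF wH nwv.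
Qed.

Lemma path_convex_chain (s : seq T) : sorted (@covers d T) s -> convex_chain [set x in s].
Proof.
move=> ps.
elim: s ps => [|x s IH] ps; first by split=> [a z b | p q]; rewrite !inE.
have /(order_path_min lt_trans) /allP xs : path <%O x s.
  by apply: sub_path ps => u v; apply: covers_lt.
have [cs chs] := IH (path_sorted ps).
have lts b : b \in x :: s -> x <= b.
  by rewrite inE => /orP[/eqP->//|/xs/ltW].
split=> [a z b|p q]; last first.
  rewrite !inE => /orP[/eqP->|ps'] /orP[/eqP->|qs].
  - exact: comparablexx.
  - by rewrite /Order.comparable ltW ?xs.
  - by rewrite /Order.comparable orbC ltW ?xs.
  by apply: chs; rewrite inE.
rewrite !in_set => aS bS az zb.
have := lts a aS => xa.
have [->|zx] := eqVneq z x; first by rewrite mem_head.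
have xz : x < z by rewrite lt_neqAle eq_sym zx (le_trans xa az).
rewrite in_cons (negPf zx) /=.
have bs : b \in s.
  by move: bS; rewrite in_cons => /orP[/eqP E|//]; rewrite E lt_geF in zb.
(* The tail is convex by induction. If [a] is the head [x], the next element of the path serves as
   [c], by [cover_le]. *)
suff [c cs' cz] : exists2 c, c \in s & c <= z.
  by have := cs c z b; rewrite !inE; apply.
move: aS; rewrite in_cons => /orP[/eqP _|]; last by exists a.
case: s ps {IH xs cs chs lts} bs {bS} => [|y s] //= /andP[xy ys] bs.
exists y; first exact: mem_head.
apply: cover_le xy xz zb _; move: bs; rewrite in_cons => /orP[/eqP-> //|bs].
have /(order_path_min lt_trans) /allP H : path <%O y s.
  by apply: sub_path ys => u v; apply: covers_lt.
exact: ltW (H b bs).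
Qed.

End Bridges.

(** * Forest posets have bridges only and no pencils *)

(** Distinct blocks of [Q] are incomparable, so a cycle stays in one block, where its edges are
    still cover relations. *)
Lemma forest_acyclic d (T : finPOrderType d) :
  forest_poset T -> forall c : seq T, ucycle (@hedge d T) c -> (size c <= 2)%N.
Proof.
case=> Q [pQ iQ tQ] [//|x c] uc.
have /bigcupP[A AQ xA] : x \in cover Q by rewrite (cover_partition pQ) inE.
have stay u v : u \in A -> hedge u v -> v \in A.
  move=> uA uv; have /bigcupP[B BQ vB] : v \in cover Q by rewrite (cover_partition pQ) inE.
  have [->//|AB] := eqVneq A B; have := iQ A B AQ BQ AB u v uA vB.
  by rewrite /Order.comparable; case/orP: uv => /covers_lt/ltW->; rewrite ?orbT.
have cA : {subset x :: c <= A}.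
  case/andP: uc => /= uc _; move: uc; rewrite rcons_path => /andP[pc _].
  elim: c x xA pc => [|y c IH] x xA /=; first by move=> _ u; rewrite inE => /eqP->.
  case/andP=> xy pc u; rewrite inE => /orP[/eqP->//|]; apply: IH pc u.
  exact: stay xA xy.
have [[_ _ ac] _] := tQ A AQ; apply: ac; case/andP: uc => uc u.
apply/andP; split=> //; move: uc; apply: (@sub_in_cycle _ (mem A)); last by apply/allP.
have cov u' v : u' \in A -> v \in A -> covers u' v -> covered_in A u' v.
  move=> uA vA /and4P[_ _ uv H]; rewrite /covered_in uA vA uv /=.
  by apply/forall_inP => z _; apply: (forall_inP H); rewrite inE.
move=> a b aA bA; rewrite hedgeE /hasse_edge => /orP[] /cov ->//; exact: orbT.
Qed.

Lemma forest_bridges d (T : finPOrderType d) : forest_poset T -> hasse_bridges T.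
Proof.
move=> fT x y xy; apply: acyclic_bridge.
- exact: hedge_sym.
- exact: forest_acyclic.
- by rewrite hedgeE xy.
by rewrite lt_eqF ?covers_lt.
Qed.

Lemma antichain2 d (T : finPOrderType d) (p q : T) :
  p >< q -> antichain [set p; q].
Proof.
move=> pq x y; rewrite !inE => /orP[]/eqP-> /orP[]/eqP->; rewrite ?eqxx //.
by rewrite comparable_sym.
Qed.

(** Everything comparable to [z] lies in the block of [z]. *)
Lemma forest_pencil_free d (T : finPOrderType d) : forest_poset T -> pencil_free T.
Proof.
case=> Q [pQ iQ tQ] p q z a b pz qz za zb pq ab.
have /bigcupP[A AQ zA] : z \in cover Q by rewrite (cover_partition pQ) inE.
have mA u : z >=< u -> u \in A.
  have /bigcupP[B BQ uB] : u \in cover Q by rewrite (cover_partition pQ) inE.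
  have [->//|AB] := eqVneq A B => zu; have := iQ A B AQ BQ AB z u zA uB.
  by rewrite zu.
have [_ np] := tQ A AQ.
apply: (np ([set p; q] :|: [set z] :|: [set a; b])).
  apply/subsetP => u; rewrite !inE -!orbA => /or4P[/eqP->|/eqP->|/eqP->//|/orP[]/eqP->];
    by apply: mA; rewrite /Order.comparable ?(ltW za) ?(ltW zb) ?(ltW pz) ?(ltW qz) ?orbT.
exists [set p; q], z, [set a; b]; split=> //.
- split; rewrite ?inE ?(lt_eqF za) ?(lt_eqF zb) ?(gt_eqF pz) ?(gt_eqF qz) //.
  rewrite disjoint_subset; apply/subsetP => u; rewrite !inE.
  by move=> /orP[]/eqP->; rewrite !lt_eqF // ?(lt_trans pz) ?(lt_trans qz).
- rewrite !cards2; split; [move: pq|move: ab]; apply: contraNT;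
    rewrite -leqNgt ltnS leqn0 eqb0 negbK => /eqP->; exact: comparablexx.
- move=> x y; rewrite !inE => /orP[]/eqP-> /orP[]/eqP->; exact/andP.
by split; apply: antichain2.
Qed.

(** * Facets and connected components of complexes *)

Lemma generated_complex (V : finType) (S : {set {set V}}) :
  simplicial_complex (generated S).
Proof.
move=> F G; rewrite !inE => /exists_inP[H HS FH] GF.
by apply/exists_inP; exists H => //; apply: subset_trans FH.
Qed.

Lemma facetsP (V : finType) (D : {set {set V}}) F :
  reflect (F \in D /\ forall G, G \in D -> F \subset G -> G = F) (F \in facets D).
Proof. by rewrite inE; apply: maxsetP. Qed.

(** Facets of [D] are pairwise incomparable under inclusion, so none of [S] is absorbed by
    another. *)
Lemma facets_generated (V : finType) (D S : {set {set V}}) :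
  S \subset facets D -> facets (generated S) = S.
Proof.
move=> /subsetP SD; apply/setP => F; apply/facetsP/idP => [[]|FS].
  rewrite inE => /exists_inP[G GS FG] /(_ G) <- //.
  by rewrite inE; apply/exists_inP; exists G.
split; first by rewrite inE; apply/exists_inP; exists F.
move=> G; rewrite inE => /exists_inP[H HS GH] FG.
apply/eqP; rewrite eqEsubset FG andbT.
have /facetsP[_ /(_ H) E] := SD F FS; have /facetsP[HD _] := SD H HS.
by rewrite -(E HD (subset_trans FG GH)).
Qed.

(* If F lies in G \in S, then C together with all subsets of G is still
   connected, so it equals C by maximality. *)
Lemma component_facet (V : finType) (S C : {set {set V}}) F :
  connected_component (generated S) C -> F \in facets C -> F \in S.
Proof.
case=> -[CD sC cC] mC /facetsP[FC mF].
have := subsetP CD F FC; rewrite inE => /exists_inP[G GS FG].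
suff E : C :|: powerset G = C.
  have GC : G \in C by rewrite -E !inE subxx orbT.
  by rewrite -(mF G GC FG).
apply: mC (subsetUl _ _); split.
- rewrite subUset CD; apply/subsetP => H; rewrite powersetE => HG.
  by rewrite inE; apply/exists_inP; exists G.
- move=> H K; rewrite !inE => /orP[HC|HG] KH; first by rewrite (sC H K).
  by rewrite (subset_trans KH HG) orbT.
pose e := [rel x y : V | [set x; y] \in C :|: powerset G].
have es : connect_sym e by apply: sym_connect_sym => x y; rewrite /e /= (setUC [set x]).
have inG u v : u \in G -> v \in G -> connect e u v.
  move=> uG vG; apply: connect1; rewrite /e /= !inE subUset !sub1set uG vG.
  by rewrite orbT.
have inC u v : [set u] \in C -> [set v] \in C -> connect e u v.
  move=> uC vC; move: (cC u v uC vC); apply: connect_sub => x y xy.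
  by apply: connect1; move: xy; rewrite /e /= inE => ->.
(* If [F] is empty, maximality leaves [C] without vertices and only [G] contributes. Otherwise a
   vertex [w] of [F] links [C] to [G]. *)
have [F0|[w wF]] := set_0Vmem F.
  have nC u : [set u] \notin C.
    apply/negP => /mF; rewrite F0 sub0set => /(_ isT)/setP/(_ u).
    by rewrite !inE eqxx.
  move=> u v; rewrite !inE (negPf (nC u)) (negPf (nC v)) !sub1set; exact: inG.
have wC : [set w] \in C by apply: sC FC _; rewrite sub1set.
have tow u : [set u] \in C :|: powerset G -> connect e u w.
  rewrite !inE sub1set => /orP[uC|uG]; first exact: inC.
  by apply: inG => //; apply: (subsetP FG).
by move=> u v uC vC; apply: connect_trans (tow u uC) _; rewrite es; apply: tow.
Qed.

Theorem theorem4p6 (d : Order.disp_t) (P : finPOrderType d) (t : nat) :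
  (2 <= t)%N -> forest_poset P -> simplicial_forest (path_complex P t).
Proof.
move=> _ fP; split; first exact: generated_complex.
move=> C cC; case: (cC) => -[CD sC coC] _; split=> // S SC nS.
have fS := facets_generated SC.
(* On the full set the traces are the facets themselves. *)
have [||||F FS LF] := @ex_leaf _ _ (forest_bridges fP) S setT.
- exact: forest_pencil_free.
- move=> F /(subsetP SC) /(component_facet cC) /imsetP[s].
  rewrite inE => ps ->; apply: path_convex_chain => //; exact: forest_bridges.
- apply: contraNneq nS => ->; apply/eqP/setP => F; rewrite !inE.
  by apply/exists_inP => -[G]; rewrite inE.
- by move=> x y z _ _ _ _; rewrite inE.
exists F; rewrite /leaf fS; split=> //; case: LF => [|[G [GS GF LG]]]; [by left|right].
exists G; split=> // H HS HF; rewrite subsetI subsetIl /=.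
by have := LG H HS HF; rewrite setIT.
Qed.
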